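(* For every pair of integers $(m,n)$ such that $m\ge 3$ and $|n|>1$, the HNN extension of $\mathrm{GL}(m,\mathbb{F}_2[t,t^{-1}])$ by $\rho_n^m$ is finitely generated, non-linear, and residually finite.
   Context: $\mathbb{F}_2$ is the field with two elements and $t$ is an indeterminate. For $m\ge 3$ and a nonzero integer $n$, $\rho_n^m:\mathrm{GL}(m,\mathbb{F}_2[t,t^{-1}])\to \mathrm{GL}(m,\mathbb{F}_2[t,t^{-1}])$ is the injective endomorphism substituting $t\mapsto t^n$ in every entry: $(\rho_n^m(A))_{ij}(t)=A_{ij}(t^n)$. The HNN extension of a group $A$ by an injective endomorphism $\phi$ of $A$ is $\langle A,\tau\mid \tau a\tau^{-1}=\phi(a),\ a\in A\rangle$. A group is linear if it admits an injective homomorphism into $\mathrm{GL}(k,F)$ for some field $F$ and some integer $k$; non-linear means not linear. *)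

(* Defs.v *)
From HB Require Import structures.
From mathcomp Require Import all_boot all_order all_fingroup all_algebra.
From mathcomp Require Import boolp.

Set Implicit Arguments.
Unset Strict Implicit.
Unset Printing Implicit Defensive.

Import GRing.Theory.
Local Notation "x %:F" := (FracField.tofrac x).
Local Open Scope ring_scope.
Local Open Scope quotient_scope.

(* K[t, t^-1] is realized as the subring of K(t) consisting of the fractions
   p / t^k with p in K[t]. *)
Section Laurent.
Variable K : fieldType.

Local Notation Kt := {fraction {poly K}}.

Definition laurent_rep (x : Kt) (pk : {poly K} * nat) : bool :=
  x == pk.1%:F / ('X%:F) ^+ pk.2.

Definition laurent_pred : {pred Kt} := fun x => `[< exists pk, laurent_rep x pk >].

Lemma laurent_predP (x : Kt) :
  reflect (exists p k, x = p%:F / ('X%:F) ^+ k) (x \in laurent_pred).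
Proof.
apply: (iffP (asboolP _)) => [[[p k] /eqP e]|[p [k e]]]; first by exists p, k.
by exists (p, k); apply/eqP.
Qed.

Lemma tofracX_neq0 : ('X : {poly K})%:F != 0 :> Kt.
Proof. by rewrite tofrac_eq0 polyX_eq0. Qed.

Lemma laurent_subring_closed : subring_closed laurent_pred.
Proof.
have X0 k : ('X : {poly K})%:F ^+ k != 0 :> Kt by rewrite expf_neq0 ?tofracX_neq0.
split.
- by apply/laurent_predP; exists 1, 0%N; rewrite expr0 divr1 tofrac1.
- move=> x y /laurent_predP[p [k ->]] /laurent_predP[q [l ->]].
  apply/laurent_predP; exists (p * 'X^l - q * 'X^k), (k + l)%N.
  rewrite -mulNr addf_div ?X0 // exprD mulNr.
  by rewrite tofracB !tofracM !tofracXn.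
- move=> x y /laurent_predP[p [k ->]] /laurent_predP[q [l ->]].
  apply/laurent_predP; exists (p * q), (k + l)%N.
  by rewrite mulf_div exprD tofracM.
Qed.

HB.instance Definition _ :=
  GRing.isSubringClosed.Build Kt laurent_pred laurent_subring_closed.

Record laurent := Laurent {
  laurent_val :> Kt;
  _ : laurent_val \in laurent_pred }.

HB.instance Definition _ := [isSub for laurent_val].
HB.instance Definition _ := [Choice of laurent by <:].
HB.instance Definition _ := [SubChoice_isSubComNzRing of laurent by <:].

Definition laurent_unit : {pred laurent} :=
  fun x => (val x != 0) && ((val x)^-1 \in laurent_pred).

End Laurent.

HB.lock Definition laurent_inv (K : fieldType) (x : laurent K) : laurent K :=
  if laurent_unit x then insubd x (val x)^-1 else x.

Section LaurentRing.
Variable K : fieldType.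

Local Notation Kt := {fraction {poly K}}.
Local Notation laurent := (laurent K).
Local Notation laurent_pred := (@laurent_pred K).
Local Notation laurent_unit := (@laurent_unit K).
Local Notation laurent_inv := (@laurent_inv K).

Lemma laurent_mulVr : {in laurent_unit, left_inverse 1 laurent_inv *%R}.
Proof.
move=> x ux; apply: val_inj; rewrite laurent_inv.unlock [laurent_unit x]ux.
case/andP: ux => x0 ix.
by rewrite rmorphM rmorph1 /= insubdK // mulVf.
Qed.

Lemma laurent_unitPl (x y : laurent) : y * x = 1 -> laurent_unit x.
Proof.
move=> /(congr1 val) e; have {}e : val y * val x = 1 by [].
have x0 : val x != 0.
  by apply/eqP => x0; move: e; rewrite x0 mulr0 => /esym/eqP; rewrite oner_eq0.
rewrite /laurent_unit x0 /=.
by have -> : (val x)^-1 = val y by [rewrite -[RHS](mulfK x0) e mul1r]; exact: valP.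
Qed.

Lemma laurent_inv_out : {in [predC laurent_unit], laurent_inv =1 id}.
Proof. by move=> x /negbTE; rewrite laurent_inv.unlock => ux; rewrite [laurent_unit x]ux. Qed.

HB.instance Definition _ := GRing.ComNzRing_hasMulInverse.Build laurent
  laurent_mulVr laurent_unitPl laurent_inv_out.

Lemma tofrac_laurent (p : {poly K}) : p%:F \in laurent_pred.
Proof. by apply/laurent_predP; exists p, 0%N; rewrite expr0 divr1. Qed.

Definition laurent_poly (p : {poly K}) : laurent := Laurent (tofrac_laurent p).

Lemma laurent_poly_is_zmod_morphism : zmod_morphism laurent_poly.
Proof. by move=> p q; apply: val_inj; rewrite rmorphB /= tofracB. Qed.

Lemma laurent_poly_is_monoid_morphism : monoid_morphism laurent_poly.
Proof.
split=> [|p q]; apply: val_inj; first by rewrite /= tofrac1.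
by rewrite /= tofracM.
Qed.

HB.instance Definition _ := GRing.isZmodMorphism.Build {poly K} laurent
  laurent_poly laurent_poly_is_zmod_morphism.
HB.instance Definition _ := GRing.isMonoidMorphism.Build {poly K} laurent
  laurent_poly laurent_poly_is_monoid_morphism.

Definition laurent_const : {rmorphism K -> laurent} := laurent_poly \o polyC.

Definition laurent_t : laurent := laurent_poly 'X.

Lemma laurent_t_unit : laurent_t \is a GRing.unit.
Proof.
have Xi : ('X : {poly K})%:F^-1 \in laurent_pred.
  by apply/laurent_predP; exists 1, 1%N; rewrite tofrac1 expr1 div1r.
suff e : Laurent Xi * laurent_t = 1 by exact: laurent_unitPl e.
by apply: val_inj; rewrite /= mulVf // tofracX_neq0.
Qed.

Lemma laurent_repP (x : laurent) : exists pk, laurent_rep (val x) pk.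
Proof. exact/asboolP/(valP x). Qed.

End LaurentRing.

(* The value at a of the Laurent polynomial x, with coefficients mapped to S
   by f; meaningful when a is a unit. *)
HB.lock Definition laurent_eval (K : fieldType) (S : comUnitRingType)
    (f : {rmorphism K -> S}) (a : S) (x : laurent K) : S :=
  let pk := xchoose (laurent_repP x) in (map_poly f pk.1).[a] / a ^+ pk.2.

Section Eval.
Variables (K : fieldType) (S : comUnitRingType) (f : {rmorphism K -> S}) (a : S).
Hypothesis ua : a \is a GRing.unit.

Local Notation Kt := {fraction {poly K}}.

Lemma laurent_evalE (x : laurent K) (p : {poly K}) (k : nat) :
  val x = p%:F / ('X%:F) ^+ k -> laurent_eval f a x = (map_poly f p).[a] / a ^+ k.
Proof.
rewrite laurent_eval.unlock; case: (xchoose _) (xchooseP (laurent_repP x)) => q l /=.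
move=> /eqP /= -> /eqP.
rewrite eqr_div ?expf_neq0 ?tofracX_neq0 // -!tofracXn -!tofracM tofrac_eq.
move=> /eqP /(congr1 (fun r => (map_poly f r).[a])).
rewrite !rmorphM /= !hornerM !map_polyXn !hornerXn => e.
by apply: (mulIr (unitrX k ua)); apply: (mulIr (unitrX l ua));
  rewrite mulrAC divrK ?unitrX // e divrK ?unitrX.
Qed.

Lemma laurent_eval_poly p : laurent_eval f a (laurent_poly p) = (map_poly f p).[a].
Proof. by rewrite (@laurent_evalE _ p 0) /= ?expr0 ?divr1. Qed.

Lemma laurent_eval_is_zmod_morphism : zmod_morphism (laurent_eval f a).
Proof.
move=> x y.
have [[p k] /eqP /= ex] := laurent_repP x; have [[q l] /eqP /= ey] := laurent_repP y.
have X0 i : ('X : {poly K})%:F ^+ i != 0 :> Kt by rewrite expf_neq0 ?tofracX_neq0.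
rewrite (laurent_evalE ex) (laurent_evalE ey).
rewrite (@laurent_evalE _ (p * 'X^l - q * 'X^k) (k + l)).
  rewrite rmorphB !rmorphM /= hornerD hornerN !hornerM !map_polyXn !hornerXn.
  apply: (mulIr (unitrX (k + l) ua)); rewrite divrK ?unitrX // mulrBl exprD.
  by rewrite mulrA divrK ?unitrX // mulrCA [X in _ - X]mulrC mulrA mulrA divrK ?unitrX //;
     rewrite ?(mulrC (a ^+ _)).
by rewrite rmorphB /= ex ey -mulNr addf_div ?X0 // exprD mulNr
  tofracB !tofracM !tofracXn.
Qed.

Lemma laurent_eval_is_monoid_morphism : monoid_morphism (laurent_eval f a).
Proof.
split=> [|x y].
  by rewrite (@laurent_evalE _ 1 0) ?expr0 ?divr1 ?tofrac1 // rmorph1 hornerC.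
have [[p k] /eqP /= ex] := laurent_repP x; have [[q l] /eqP /= ey] := laurent_repP y.
rewrite (laurent_evalE ex) (laurent_evalE ey).
rewrite (@laurent_evalE _ (p * q) (k + l)).
  rewrite rmorphM hornerM exprD invrM ?unitrX // [RHS]mulrACA.
  by congr (_ * _); rewrite mulrC.
by rewrite rmorphM /= ex ey mulf_div exprD tofracM.
Qed.

End Eval.

HB.lock Definition laurent_subst (K : fieldType) (n : int) : laurent K -> laurent K :=
  laurent_eval (laurent_const K) (laurent_t K ^ n).

Section LaurentSubst.
Variable K : fieldType.

Local Notation laurent := (laurent K).
Local Notation laurent_const := (laurent_const K).
Local Notation laurent_t := (laurent_t K).
Local Notation laurent_t_unit := (laurent_t_unit K).
Local Notation laurent_poly := (@laurent_poly K).
Local Notation laurent_subst := (@laurent_subst K).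

Lemma laurent_tX_unit (n : int) : laurent_t ^ n \is a GRing.unit.
Proof. by rewrite unitrXz ?laurent_t_unit. Qed.

Lemma laurent_subst_is_zmod_morphism n : zmod_morphism (laurent_subst n).
Proof.
by rewrite laurent_subst.unlock; apply/laurent_eval_is_zmod_morphism/laurent_tX_unit.
Qed.

Lemma laurent_subst_is_monoid_morphism n : monoid_morphism (laurent_subst n).
Proof.
by rewrite laurent_subst.unlock; apply/laurent_eval_is_monoid_morphism/laurent_tX_unit.
Qed.

HB.instance Definition _ (n : int) := GRing.isZmodMorphism.Build laurent laurent
  (laurent_subst n) (laurent_subst_is_zmod_morphism n).
HB.instance Definition _ (n : int) := GRing.isMonoidMorphism.Build laurent laurent
  (laurent_subst n) (laurent_subst_is_monoid_morphism n).

Lemma laurent_subst_const n c : laurent_subst n (laurent_const c) = laurent_const c.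
Proof.
by rewrite laurent_subst.unlock laurent_eval_poly ?laurent_tX_unit // map_polyC hornerC.
Qed.

Lemma laurent_subst_t n : laurent_subst n laurent_t = laurent_t ^ n.
Proof.
by rewrite laurent_subst.unlock laurent_eval_poly ?laurent_tX_unit // map_polyX hornerX.
Qed.

Lemma laurentP (x : laurent) :
  exists p k, x = laurent_poly p / laurent_t ^+ k.
Proof.
have [[p k] /eqP /= e] := laurent_repP x; exists p, k.
apply: (mulIr (unitrX k laurent_t_unit)); rewrite divrK ?unitrX ?laurent_t_unit //.
apply: val_inj; rewrite rmorphM rmorphXn /= [laurent_val x]e divfK //.
by rewrite expf_neq0 ?tofracX_neq0.
Qed.

Lemma laurent_rmorph_ext (S : comUnitRingType) (f g : {rmorphism laurent -> S}) :
  f \o laurent_const =1 g \o laurent_const -> f laurent_t = g laurent_t -> f =1 g.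
Proof.
move=> ec et x.
have ep p : f (laurent_poly p) = g (laurent_poly p).
  elim/poly_ind: p => [|p c IH]; first by rewrite !rmorph0.
  rewrite rmorphD rmorphM !(rmorphD, rmorphM) IH; congr (_ * _ + _) => //.
  exact: ec.
have [p [k ->]] := laurentP x.
by rewrite !rmorph_div ?unitrX ?laurent_t_unit // !rmorphXn et ep.
Qed.

Lemma laurent_poly_inj : injective laurent_poly.
Proof. by move=> p q /(congr1 val) /= /eqP; rewrite tofrac_eq => /eqP. Qed.

Lemma laurent_subst_poly (k : nat) p :
  laurent_subst k (laurent_poly p) = laurent_poly (p \Po 'X^k).
Proof.
rewrite laurent_subst.unlock laurent_eval_poly ?laurent_tX_unit //.
have -> : laurent_t ^ k = laurent_poly 'X^k by rewrite rmorphXn.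
by rewrite map_poly_comp horner_map.
Qed.

Lemma laurent_subst_comp (n k : int) (x : laurent) :
  laurent_subst n (laurent_subst k x) = laurent_subst (n * k) x.
Proof.
apply: (laurent_rmorph_ext (f := laurent_subst n \o laurent_subst k)
    (g := laurent_subst (n * k))) => [c|].
  by rewrite /= !laurent_subst_const.
by rewrite /= !laurent_subst_t rmorphXz ?laurent_t_unit //= laurent_subst_t exprz_exp.
Qed.

Lemma laurent_subst1 (x : laurent) : laurent_subst 1 x = x.
Proof.
apply: (laurent_rmorph_ext (f := laurent_subst 1) (g := idfun)) => [c|] /=.
  by rewrite laurent_subst_const.
by rewrite laurent_subst_t.
Qed.

Lemma laurent_subst_inj (n : int) : n != 0 -> injective (laurent_subst n).
Proof.
have injS k : injective (laurent_subst k.+1).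
  apply: raddf_inj => x; have [p [j ->]] := laurentP x.
  rewrite /= rmorph_div ?unitrX ?laurent_t_unit //= laurent_subst_poly rmorphXn /=.
  rewrite laurent_subst_t => /(congr1 (fun y => y * (laurent_t ^ k.+1) ^+ j)).
  rewrite mul0r divrK ?(unitrX j (laurent_tX_unit k.+1)) // => e.
  have /eqP : p \Po 'X^(k.+1) = 0 by apply: laurent_poly_inj; rewrite e rmorph0.
  rewrite comp_poly_eq0; first by move=> /eqP ->; rewrite rmorph0 mul0r.
  by rewrite size_polyXn.
case: n => [[|k]|k] n0; [by case/eqP: n0|exact: injS|].
have e : -1 * Negz k = k.+1 :> int by rewrite NegzE mulN1r opprK.
move=> x y /(congr1 (laurent_subst (-1))); rewrite !laurent_subst_comp e.
exact: injS.
Qed.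

End LaurentSubst.

(* The library's {'GL_n[R]} requires R to be finite. *)
Section GL.
Variables (m : nat) (R : comUnitRingType).

Record GL := GLmx { GL_val :> 'M[R]_m; _ : GL_val \in unitmx }.

HB.instance Definition _ := [isSub for GL_val].
HB.instance Definition _ := [Choice of GL by <:].

Definition GL_mul (A B : GL) : GL :=
  GLmx (etrans (unitmx_mul (val A) (val B)) (introT andP (conj (valP A) (valP B)))).
Definition GL_one : GL := GLmx (unitmx1 R m).
Definition GL_inv (A : GL) : GL := GLmx (etrans (unitmx_inv (val A)) (valP A)).

Fact GL_mulA : associative GL_mul.
Proof. by move=> A B C; apply: val_inj; apply: mulmxA. Qed.
Fact GL_mul1 : left_id GL_one GL_mul.
Proof. by move=> A; apply: val_inj; apply: mul1mx. Qed.
Fact GL_mulr1 : right_id GL_one GL_mul.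
Proof. by move=> A; apply: val_inj; apply: mulmx1. Qed.
Fact GL_mulV : left_inverse GL_one GL_inv GL_mul.
Proof. by move=> A; apply: val_inj; apply: mulVmx; apply: valP. Qed.
Fact GL_mulrV : right_inverse GL_one GL_inv GL_mul.
Proof. by move=> A; apply: val_inj; apply: mulmxV; apply: valP. Qed.

HB.instance Definition _ :=
  isGroup.Build GL GL_mulA GL_mul1 GL_mulr1 GL_mulV GL_mulrV.

End GL.

Section GLmap.
Variables (m : nat) (R S : comUnitRingType) (f : {rmorphism R -> S}).

Fact GL_map_subproof (A : GL m R) : map_mx f A \in unitmx.
Proof. by rewrite unitmxE det_map_mx rmorph_unit // -unitmxE; apply: valP. Qed.

Definition GL_map (A : GL m R) : GL m S := GLmx (GL_map_subproof A).

Fact GL_map_multiplicative : {morph GL_map : A B / (A * B)%g}.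
Proof. by move=> A B; apply: val_inj; apply: map_mxM. Qed.

HB.instance Definition _ :=
  isMultiplicative.Build (GL m R) (GL m S) GL_map GL_map_multiplicative.

Lemma GL_map_inj : injective f -> injective GL_map.
Proof.
move=> injf A B /(congr1 val) /matrixP e; apply/val_inj/matrixP => i j.
by have := e i j; rewrite !mxE => /injf.
Qed.

End GLmap.

(* The group < A, tau | tau a tau^-1 = phi(a) >: words over A and tau^{+-1}
   modulo the congruence generated by the relations.  It is the HNN extension
   of A by phi when phi is injective. *)
Section HNN.
Variables (A : groupType) (phi : {multiplicative A -> A}).

(* inl a stands for a, inr true for tau, inr false for tau^-1. *)
Definition hnn_word := seq (A + bool).

Inductive hnn_rel : hnn_word -> hnn_word -> Prop :=
| hnn_refl u : hnn_rel u u
| hnn_sym u v : hnn_rel u v -> hnn_rel v u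
| hnn_trans u v w : hnn_rel u v -> hnn_rel v w -> hnn_rel u w
| hnn_cat u u' v v' : hnn_rel u u' -> hnn_rel v v' -> hnn_rel (u ++ v) (u' ++ v')
| hnn_one : hnn_rel [:: inl 1%g] [::]
| hnn_mul a b : hnn_rel [:: inl a; inl b] [:: inl (a * b)%g]
| hnn_tauV : hnn_rel [:: inr true; inr false] [::]
| hnn_Vtau : hnn_rel [:: inr false; inr true] [::]
| hnn_conj a : hnn_rel [:: inr true; inl a; inr false] [:: inl (phi a)].

Definition hnn_equiv (u v : hnn_word) : bool := `[< hnn_rel u v >].

Fact hnn_equiv_refl : reflexive hnn_equiv.
Proof. by move=> u; apply/asboolP/hnn_refl. Qed.
Fact hnn_equiv_sym : symmetric hnn_equiv.
Proof. by move=> u v; apply/asboolP/asboolP; apply: hnn_sym. Qed.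
Fact hnn_equiv_trans : transitive hnn_equiv.
Proof.
by move=> v u w /asboolP uv /asboolP vw; apply/asboolP/(hnn_trans uv vw).
Qed.

Canonical hnn_equiv_rel :=
  EquivRel hnn_equiv hnn_equiv_refl hnn_equiv_sym hnn_equiv_trans.

Definition hnn := {eq_quot hnn_equiv}.

HB.instance Definition _ := Choice.on hnn.
HB.instance Definition _ := EqQuotient.on hnn.

Definition hnn_class (u : hnn_word) : hnn := \pi_hnn u.

Lemma hnn_classP (u v : hnn_word) : hnn_class u = hnn_class v <-> hnn_rel u v.
Proof.
split=> [/eqmodP /asboolP //|uv].
by apply/eqmodP/asboolP.
Qed.

Definition hnn_letter_inv (x : A + bool) : A + bool :=
  match x with inl a => inl a^-1%g | inr b => inr (~~ b) end.

Definition hnn_word_inv (u : hnn_word) : hnn_word := rev (map hnn_letter_inv u).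

Local Notation repr := generic_quotient.repr.

Definition hnn_mulg (x y : hnn) : hnn := hnn_class (repr x ++ repr y).
Definition hnn_oneg : hnn := hnn_class [::].
Definition hnn_invg (x : hnn) : hnn := hnn_class (hnn_word_inv (repr x)).

Lemma hnn_classK (x : hnn) : hnn_class (repr x) = x.
Proof. exact: reprK. Qed.

Lemma hnn_rel_repr u : hnn_rel (repr (hnn_class u)) u.
Proof. by apply/hnn_classP; rewrite hnn_classK. Qed.

Lemma hnn_mulgE u v : hnn_mulg (hnn_class u) (hnn_class v) = hnn_class (u ++ v).
Proof. by apply/hnn_classP/hnn_cat; apply: hnn_rel_repr. Qed.

Lemma hnn_letter_mulV x : hnn_rel [:: hnn_letter_inv x; x] [::].
Proof.
case: x => [a|[]] /=; [|exact: hnn_Vtau|exact: hnn_tauV].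
by apply: hnn_trans (hnn_mul _ _) _; rewrite mulVg; apply: hnn_one.
Qed.

Lemma hnn_letter_mulrV x : hnn_rel [:: x; hnn_letter_inv x] [::].
Proof.
case: x => [a|[]] /=; [|exact: hnn_tauV|exact: hnn_Vtau].
by apply: hnn_trans (hnn_mul _ _) _; rewrite mulgV; apply: hnn_one.
Qed.

Lemma hnn_word_mulV u : hnn_rel (hnn_word_inv u ++ u) [::].
Proof.
elim: u => [|x u IH]; first exact: hnn_refl.
have -> : hnn_word_inv (x :: u) ++ x :: u
    = hnn_word_inv u ++ [:: hnn_letter_inv x; x] ++ u.
  by rewrite /hnn_word_inv /= rev_cons -cats1 -catA.
apply: hnn_trans IH; apply: hnn_cat; first exact: hnn_refl.
exact: (hnn_cat (hnn_letter_mulV x) (hnn_refl u)).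
Qed.

Lemma hnn_word_mulrV u : hnn_rel (u ++ hnn_word_inv u) [::].
Proof.
elim: u => [|x u IH]; first exact: hnn_refl.
have -> : (x :: u) ++ hnn_word_inv (x :: u)
    = [:: x] ++ (u ++ hnn_word_inv u) ++ [:: hnn_letter_inv x].
  by rewrite /hnn_word_inv /= rev_cons -cats1 catA.
apply: hnn_trans (hnn_letter_mulrV x).
apply: (hnn_cat (hnn_refl [:: x])).
exact: (hnn_cat IH (hnn_refl [:: hnn_letter_inv x])).
Qed.

Fact hnn_mulgA : associative hnn_mulg.
Proof.
move=> x y z; rewrite -(hnn_classK x) -(hnn_classK y) -(hnn_classK z).
by rewrite !hnn_mulgE catA.
Qed.
Fact hnn_mul1g : left_id hnn_oneg hnn_mulg.
Proof. by move=> x; rewrite -(hnn_classK x) hnn_mulgE. Qed.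
Fact hnn_mulg1 : right_id hnn_oneg hnn_mulg.
Proof. by move=> x; rewrite -(hnn_classK x) hnn_mulgE cats0. Qed.
Fact hnn_mulVg : left_inverse hnn_oneg hnn_invg hnn_mulg.
Proof.
move=> x; rewrite -{2}(hnn_classK x) hnn_mulgE.
by apply/hnn_classP/hnn_word_mulV.
Qed.
Fact hnn_mulgV : right_inverse hnn_oneg hnn_invg hnn_mulg.
Proof.
move=> x; rewrite -{1}(hnn_classK x) hnn_mulgE.
by apply/hnn_classP/hnn_word_mulrV.
Qed.

HB.instance Definition _ :=
  isGroup.Build hnn hnn_mulgA hnn_mul1g hnn_mulg1 hnn_mulVg hnn_mulgV.

End HNN.

Section GroupProperties.
Variable G : groupType.

Definition finitely_generated : Prop :=
  exists s : seq G, forall x : G, exists w : seq G,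
    all (fun y => (y \in s) || (y^-1%g \in s)) w /\ x = (\prod_(y <- w) y)%g.

Definition linear_group : Prop :=
  exists (F : fieldType) (k : nat) (f : {multiplicative G -> GL k F}), injective f.

Definition residually_finite : Prop :=
  forall x : G, x != 1%g ->
    exists (H : finGroupType) (f : {multiplicative G -> H}), f x != 1%g.

End GroupProperties.

Definition rho (m : nat) (n : int) :
    {multiplicative GL m (laurent 'F_2) -> GL m (laurent 'F_2)} :=
  GL_map (laurent_subst n).

Lemma rho_inj (m : nat) (n : int) : n != 0 -> injective (rho m n).
Proof. by move=> n0; apply/GL_map_inj/laurent_subst_inj. Qed.

(* Main.v *)
From HB Require Import structures.
Require Import Defs.
From mathcomp Require Import all_boot all_order all_algebra.
From mathcomp Require Import all_fingroup all_solvable all_field.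

(** Write R = F_2[t,t^-1], G = GL(m,R), and tau for the stable letter, so that
    tau a tau^-1 = rho(a), where rho substitutes t^n for t.

    Finite generation.  G is generated by the finite group GL(m,F_2), the scalar
    matrix t and the diagonal matrices D_i with a single entry t: conjugating by
    D_i multiplies by t the entries of an elementary matrix in row i, so all
    elementary matrices over F_2[t] are obtained ([subgroup_shear]).  An
    invertible matrix over F_2[t] is reduced to a constant one by lowering its
    row degrees: when the matrix of leading row coefficients is singular, a row
    operation lowers one row degree, and otherwise the sum of the row degrees is
    the degree of the determinant, which is 0 ([subgroup_GL_poly]).  A polynomial
    matrix whose determinant is a power of t is reduced to that case: when it is
    singular at t = 0, a row operation makes some row divisible by t, and this
    factor is carried by D_i ([subgroup_poly_mx]).

    Residual finiteness.  Since tau a = rho(a) tau, every element of the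
    extension is tau^-i a tau^j ([hnn_normal_form]).  If i <> j, it survives in a
    finite cyclic quotient counting tau.  If i = j, it is conjugate to a in G.
    Let K be a finite field of characteristic 2 with |K^*| prime to n.  Then G
    acts on K^* x K^m by (x, v) a = (x, v a(x)), the map (x, v) tau = (x^n, v) is
    a permutation, and the two satisfy the defining relations, because
    rho(a)(x) = a(x^n) ([pow_perm_conj]).  For K large a nonzero Laurent
    polynomial has a nonroot in K^*, so a nontrivial a acts nontrivially.  In
    particular G embeds in the extension ([hnn_base_rho_inj]).

    Non-linearity.  Suppose that the extension embeds in GL(k,F).  The matrices
    1 + t^e E_12 are infinitely many commuting involutions; if 2 <> 0 in F,
    commuting involutions are simultaneously diagonal with entries 1 and -1, so
    there are at most 2^k of them ([commuting_involutions_bound]).  Hence F has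
    characteristic 2.  The scalar t is conjugate under tau^2 to its n^2-th power,
    so that all eigenvalues of its image are roots of unity; in characteristic 2
    an invertible matrix with this property has finite order
    ([conj_pow_finite_order]), whereas t has infinite order. *)

Set Implicit Arguments.
Unset Strict Implicit.
Unset Printing Implicit Defensive.

Import Order.TTheory GRing.Theory Num.Theory.
Local Open Scope ring_scope.

(** * Homomorphisms of groups and the structure of ascending HNN extensions *)

Section GroupMorphism.
Variables (G H : groupType) (f : {multiplicative G -> H}).
Local Open Scope group_scope.

Lemma group_morph1 : f 1 = 1.
Proof. by apply: (mulgI (f 1)); rewrite -gmulfM !mulg1. Qed.

Lemma group_morphV x : f x^-1 = (f x)^-1.
Proof. by apply/esym/mulg1_eq; rewrite -gmulfM mulgV group_morph1. Qed.

Lemma group_morphX x k : f (x ^+ k) = f x ^+ k.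
Proof.
by elim: k => [|k IH]; rewrite ?expg0 ?group_morph1 // !expgS gmulfM IH.
Qed.

End GroupMorphism.

Section HNNLift.
Variables (A : groupType) (phi : {multiplicative A -> A}).
Local Open Scope group_scope.

Definition hnn_base (a : A) : hnn phi := hnn_class phi [:: inl a].
Definition hnn_tau : hnn phi := hnn_class phi [:: inr true].

Lemma hnn_classM (u v : hnn_word A) :
  hnn_class phi (u ++ v) = hnn_class phi u * hnn_class phi v.
Proof. by rewrite -hnn_mulgE. Qed.

Fact hnn_base_multiplicative : {morph hnn_base : a b / a * b}.
Proof. by move=> a b; rewrite -hnn_classM; apply/esym/hnn_classP/hnn_mul. Qed.

HB.instance Definition _ :=
  isMultiplicative.Build A (hnn phi) hnn_base hnn_base_multiplicative.

Lemma hnn_tauV_class : hnn_class phi [:: inr false] = hnn_tau^-1.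
Proof.
apply/esym/mulg1_eq; rewrite -hnn_classM.
exact/hnn_classP/hnn_tauV.
Qed.

Lemma hnn_tau_base a : hnn_tau * hnn_base a = hnn_base (phi a) * hnn_tau.
Proof.
apply/(canRL (mulgVK hnn_tau)); rewrite -hnn_tauV_class.
rewrite -(hnn_classM [:: inr true] [:: inl a]) -hnn_classM.
exact/hnn_classP/hnn_conj.
Qed.

Lemma hnn_ind (P : hnn phi -> Prop) :
  P 1 -> (forall a x, P x -> P (hnn_base a * x)) ->
  (forall x, P x -> P (hnn_tau * x)) -> (forall x, P x -> P (hnn_tau^-1 * x)) ->
  forall x, P x.
Proof.
move=> P1 Pa Pt PV x; rewrite -(hnn_classK x).
elim: (generic_quotient.repr x) => [//|l u IH].
rewrite -cat1s hnn_classM; case: l => [a|[]]; [exact: Pa|exact: Pt|].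
by rewrite hnn_tauV_class; apply: PV.
Qed.

Lemma hnn_tauX_base i a :
  hnn_tau ^+ i * hnn_base a = hnn_base (iter i phi a) * hnn_tau ^+ i.
Proof.
elim: i a => [|i IH] a; first by rewrite mul1g mulg1.
by rewrite !expgS -mulgA IH !mulgA hnn_tau_base.
Qed.

(** As tau a = phi(a) tau, positive powers of tau move to the right of the base
    group and negative ones to its left. *)
Lemma hnn_normal_form x :
  exists i a j, x = hnn_tau ^- i * hnn_base a * hnn_tau ^+ j.
Proof.
elim/hnn_ind: x => [|b x [i [a [j ->]]]|x [i [a [j ->]]]|x [i [a [j ->]]]].
- by exists 0%N, 1, 0%N; rewrite group_morph1 !mulg1 invg1.
- exists i, (iter i phi b * a), j; rewrite gmulfM !mulgA; congr (_ * _ * _).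
  by apply: (mulgI (hnn_tau ^+ i)); rewrite !mulgA hnn_tauX_base mulgV mul1g mulgK.
- case: i => [|i].
    exists 0%N, (phi a), j.+1.
    by rewrite invg1 !mul1g mulgA hnn_tau_base -mulgA expgS.
  by exists i, a, j; rewrite expgSr invgM !mulgA mulgV mul1g.
- by exists i.+1, a, j; rewrite expgSr invgM !mulgA.
Qed.

(** ** The universal property *)

Section Lift.
Variables (H : groupType) (g : {multiplicative A -> H}) (c : H).
Hypothesis gc : forall a, c * g a * c^-1 = g (phi a).

Definition hnn_letter_lift (l : A + bool) : H :=
  match l with inl a => g a | inr true => c | inr false => c^-1 end.

Definition hnn_word_lift (u : hnn_word A) : H :=
  \prod_(l <- u) hnn_letter_lift l.

Lemma hnn_word_lift_rel u v :
  hnn_rel phi u v -> hnn_word_lift u = hnn_word_lift v.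
Proof.
rewrite /hnn_word_lift.
elim=> {u v} => //= [u v w _ -> _ -> //|u u' v v' _ eu _ ev||a b|||a];
  rewrite ?big_cat /= ?big_cons ?big_nil /= ?mulg1.
- by rewrite eu ev.
- exact: group_morph1.
- by rewrite gmulfM.
- exact: mulgV.
- exact: mulVg.
- by rewrite mulgA gc.
Qed.

Definition hnn_lift (x : hnn phi) : H := hnn_word_lift (generic_quotient.repr x).

Lemma hnn_lift_class u : hnn_lift (hnn_class phi u) = hnn_word_lift u.
Proof. exact/hnn_word_lift_rel/hnn_rel_repr. Qed.

Fact hnn_lift_multiplicative : {morph hnn_lift : x y / x * y}.
Proof.
move=> x y; rewrite -(hnn_classK x) -(hnn_classK y) -hnn_classM !hnn_lift_class.
exact: big_cat.
Qed.

Lemma hnn_lift_base a : hnn_lift (hnn_base a) = g a.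
Proof. by rewrite hnn_lift_class /hnn_word_lift big_seq1. Qed.

Lemma hnn_lift_tau : hnn_lift hnn_tau = c.
Proof. by rewrite hnn_lift_class /hnn_word_lift big_seq1. Qed.

HB.instance Definition _ :=
  isMultiplicative.Build (hnn phi) H hnn_lift hnn_lift_multiplicative.

Lemma hnn_lift_exists : exists f : {multiplicative hnn phi -> H},
  (forall a, f (hnn_base a) = g a) /\ f hnn_tau = c.
Proof. by exists hnn_lift; split; [exact: hnn_lift_base|exact: hnn_lift_tau]. Qed.

End Lift.
End HNNLift.

(** * Residual finiteness *)

Section LaurentAt.
Variables (F : fieldType) (S : comUnitRingType) (f : {rmorphism F -> S}).
Variable a : S.

(** The proof that a is a unit is an argument, so that this evaluation can be
    given the structure of a ring morphism. *)
Definition laurent_at of a \is a GRing.unit : laurent F -> S := laurent_eval f a.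

Variable ua : a \is a GRing.unit.

HB.instance Definition _ := GRing.isZmodMorphism.Build (laurent F) S
  (laurent_at ua) (laurent_eval_is_zmod_morphism f ua).
HB.instance Definition _ := GRing.isMonoidMorphism.Build (laurent F) S
  (laurent_at ua) (laurent_eval_is_monoid_morphism f ua).

Lemma laurent_at_const c : laurent_at ua (laurent_const F c) = f c.
Proof. by rewrite /laurent_at laurent_eval_poly // map_polyC hornerC. Qed.

Lemma laurent_at_t : laurent_at ua (laurent_t F) = a.
Proof. by rewrite /laurent_at laurent_eval_poly // map_polyX hornerX. Qed.

End LaurentAt.

Lemma laurent_at_subst (F : fieldType) (S : comUnitRingType)
    (f : {rmorphism F -> S}) (a : S) (n : int)
    (ua : a \is a GRing.unit) (uan : a ^ n \is a GRing.unit) (x : laurent F) :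
  laurent_at f ua (laurent_subst n x) = laurent_at f uan x.
Proof.
apply: (@laurent_rmorph_ext F S (laurent_at f ua \o laurent_subst n) (laurent_at f uan)).
  by move=> c; rewrite /= laurent_subst_const !laurent_at_const.
by rewrite /= laurent_subst_t rmorphXz ?laurent_t_unit //= !laurent_at_t.
Qed.

Section FiniteAction.
Variables (F : fieldType) (K : finFieldType) (f : {rmorphism F -> K}) (m : nat) (n : int).
Hypothesis co_n : coprime `|n| #|K|.-1.

Local Notation X := ({unit K} * 'rV[K]_m)%type.

Definition unit_pow (x : {unit K}) : {unit K} :=
  FinRing.unit K (unitrXz n (valP x)).

(** If x^n = y^n, then the order of x / y divides both n and |K^*|. *)
Lemma unit_pow_inj : injective unit_pow.
Proof.
move=> x y /(congr1 val) /= exy.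
have ez : (val x / val y) ^ n = 1.
  by rewrite expfzMl -expfV exy divrr // unitrXz //; exact: valP.
pose z := (x * y^-1)%g; have vz : val z = val x / val y by [].
have : (z ^+ `|n|)%g = 1%g.
  apply/val_inj; rewrite FinRing.val_unitX vz /=.
  case: n ez => k //= /(congr1 (fun u => u^-1)); rewrite invr1 => <-.
  by rewrite /exprz invrK.
move/eqP; rewrite -order_dvdn => dz.
have : (#[z]%g %| gcdn `|n| #|K|.-1)%N.
  by rewrite dvdn_gcd dz -card_finField_unit order_dvdG ?inE.
rewrite (eqP co_n) dvdn1 order_eq1 => /eqP z1.
by apply: (mulIg y^-1%g); rewrite mulgV.
Qed.

(** Row vectors turn the product of G into the composition of permutations from
    left to right. *)
Definition eval_act (a : GL m (laurent F)) (p : X) : X :=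
  (p.1, p.2 *m GL_map (laurent_at f (valP p.1)) a).

Lemma eval_actM a b p : eval_act (a * b)%g p = eval_act b (eval_act a p).
Proof. by rewrite /eval_act gmulfM /= mulmxA. Qed.

Lemma eval_act1 p : eval_act 1%g p = p.
Proof. by case: p => x v; rewrite /eval_act group_morph1 /= mulmx1. Qed.

Lemma eval_act_inj a : injective (eval_act a).
Proof.
by apply: (can_inj (g := eval_act a^-1%g)) => p; rewrite -eval_actM mulgV eval_act1.
Qed.

Definition eval_perm a : {perm X} := perm (@eval_act_inj a).

Fact eval_perm_multiplicative : {morph eval_perm : a b / (a * b)%g}.
Proof. by move=> a b; apply/permP => p; rewrite permM !permE eval_actM. Qed.

HB.instance Definition _ := isMultiplicative.Build (GL m (laurent F)) {perm X}
  eval_perm eval_perm_multiplicative.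

Definition pow_act (p : X) : X := (unit_pow p.1, p.2).

Lemma pow_act_inj : injective pow_act.
Proof. by move=> [x v] [y w] [/= e ->]; rewrite (@unit_pow_inj x y) //; apply/val_inj. Qed.

Definition pow_perm : {perm X} := perm pow_act_inj.

(** Acting by tau, a and tau^-1 in turn sends (x, v) to (x^n, v), then to
    (x^n, v a(x^n)), and finally to (x, v a(x^n)). *)
Lemma pow_perm_conj a :
  (pow_perm * eval_perm a * pow_perm^-1)%g = eval_perm (GL_map (laurent_subst n) a).
Proof.
apply/(canLR (mulgK _))/permP => -[x v].
rewrite !permM !permE /eval_act /pow_act /=; congr (_, _ *m _).
apply/matrixP => i j; rewrite !mxE.
by rewrite (laurent_at_subst _ _ (valP (unit_pow x))).
Qed.

End FiniteAction.

(** The numerator of y has fewer roots than K has units once K is large. *)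
Lemma laurent_at_nonroot (F : fieldType) (y : laurent F) : y != 0 ->
  exists B, forall (K : finFieldType) (f : {rmorphism F -> K}), (B < #|K|.-1)%N ->
    exists x : {unit K}, laurent_at f (valP x) y != 0.
Proof.
have [p [k ->]] := laurentP y => y0.
have p0 : p != 0 by apply: contraNneq y0 => ->; rewrite rmorph0 mul0r.
exists (size p) => K f ltB.
have fp0 : map_poly f p != 0 by rewrite map_poly_eq0.
have [x fx|all0] := pickP (fun x : {unit K} => ~~ root (map_poly f p) (val x)).
  exists x; rewrite rmorph_div ?unitrX ?laurent_t_unit // rmorphXn /= laurent_at_t.
  rewrite mulf_neq0 //; first by rewrite /laurent_at laurent_eval_poly // (valP x).
  by rewrite invr_eq0 expf_neq0 // -unitfE; exact: valP.
suff : (#|K|.-1 < size p)%N by rewrite ltnNge (ltnW ltB).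
have := @max_poly_roots _ _ [seq val x | x : {unit K}] fp0.
rewrite size_map_poly size_map -cardE -cardsT card_finField_unit; apply.
- by apply/allP => _ /mapP[x _ ->]; have /negbFE := all0 x.
- by rewrite map_inj_uniq ?enum_uniq //; exact: val_inj.
Qed.

(** Let N' be the odd part of N and e = 1 mod totient N'.  By Euler's theorem,
    2^e = 2 mod N', so 2^e - 1 is 1 modulo N'; being odd, it is prime to N. *)
Lemma finField2_coprime (N B : nat) : (0 < N)%N ->
  exists (K : finFieldType) (f : {rmorphism 'F_2 -> K}),
    coprime N #|K|.-1 /\ (B < #|K|.-1)%N.
Proof.
move=> N0; pose N' := (N`_2^')%N; pose e := (B.+1 * totient N').+1.
have [K charK cardK] := @pPrimePowerField 2 e isT isT.
have e_gt : (B.+1 < e)%N.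
  by rewrite ltnS leq_pmulr // totient_gt0 part_gt0.
(* K is an algebra over its prime field through the alias pPrimeCharType. *)
exists K, ((GRing.in_alg (pPrimeCharType charK) :
  {rmorphism 'F_2 -> pPrimeCharType charK}) : {rmorphism 'F_2 -> K}).
have lte : (e < 2 ^ e)%N by rewrite ltn_expl.
rewrite cardK; split; last first.
  by rewrite -ltnS prednK ?expn_gt0 //; apply: leq_trans lte; apply: ltnW.
have odd1 : odd (2 ^ e).-1 by rewrite -subn1 oddB ?expn_gt0 // oddX.
rewrite -(partnC 2%N N0) coprimeMl; apply/andP; split.
  by rewrite p_part coprimeXl // coprime2n.
have coN' : coprime 2 N'.
  by rewrite prime_coprime // -p'natE // part_pnat.
have e1 : (2 ^ e).-1 = 1 %[mod N'].
  apply/eqP; rewrite -(eqn_modDr 1) addn1 prednK ?expn_gt0 //.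
  rewrite /e expnS mulnC expnM.
  by rewrite -modnMml Euler_exp_totient ?coprimeXl // modnMml mul1n.
by rewrite -/N' -coprime_modr e1 coprime_modr coprimen1.
Qed.

Section RhoHNN.
Variables (m : nat) (n : int).
Hypothesis n0 : n != 0.

Lemma hnn_rho_base_separated (a : GL m (laurent 'F_2)) : a != 1%g ->
  exists (H : finGroupType) (f : {multiplicative hnn (rho m n) -> H}),
    f (hnn_base (rho m n) a) != 1%g.
Proof.
move=> a1.
have /existsP[i /existsP[j nij]] : [exists i, exists j, val a i j != (i == j)%:R].
  apply: contraNT a1; rewrite negb_exists => /forallP a1.
  apply/eqP/val_inj/matrixP => i j; rewrite !mxE.
  by have := a1 i; rewrite negb_exists => /forallP /(_ j); rewrite negbK => /eqP.
rewrite -subr_eq0 in nij.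
have [B BP] := laurent_at_nonroot nij.
have [K [f [co ltB]]] := @finField2_coprime `|n| B (etrans (absz_gt0 n) n0).
have [x xP] := BP K f ltB.
have [g [gb _]] := hnn_lift_exists (pow_perm_conj (m := m) f co).
(* At (x, i-th basis vector) the action of a reads off the i-th row of a(x). *)
exists _, g; rewrite gb; apply: contraNneq xP => /permP /(_ (x, delta_mx 0 i)).
rewrite permE perm1 => -[/rowP /(_ j)]; rewrite -rowE !mxE => e.
by rewrite rmorphB rmorph_nat /= [X in X - _]e eqxx (eq_sym j) subrr.
Qed.

Lemma hnn_tau_exponent_separated (i j : nat) (a : GL m (laurent 'F_2)) : i != j ->
  exists (H : finGroupType) (f : {multiplicative hnn (rho m n) -> H}),
    f (hnn_tau (rho m n) ^- i * hnn_base (rho m n) a * hnn_tau (rho m n) ^+ j)%g != 1%g.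
Proof.
move=> ij; pose c : 'I_(i + j).+1 := Zp1.
pose g : {multiplicative GL m (laurent 'F_2) -> 'I_(i + j).+1} := one_fun 'I_(i + j).+1.
have gc b : (c * g b * c^-1 = g (rho m n b))%g by rewrite /= mulg1 mulgV.
have [f [fb ft]] := hnn_lift_exists gc.
exists _, f; rewrite !gmulfM group_morphV !group_morphX fb ft /= mulg1.
rewrite -eq_mulVg1 eq_expg_mod_order order_Zp1 !modn_small //.
- by rewrite ltnS leq_addl.
- by rewrite ltnS leq_addr.
Qed.

Lemma hnn_rho_residually_finite : residually_finite (hnn (rho m n)).
Proof.
move=> x; have [i [a [j ->]]] := hnn_normal_form x => x1.
have [eij|] := eqVneq i j; last exact: hnn_tau_exponent_separated.
have a1 : a != 1%g.
  by apply: contraNneq x1 => ->; rewrite eij group_morph1 mulg1 mulVg.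
have [H [f fa]] := hnn_rho_base_separated a1.
exists H, f; apply: contraNneq fa.
move=> /(congr1 (fun y => y ^ (f (hnn_tau (rho m n)) ^- j))%g).
rewrite eij !gmulfM group_morphV !group_morphX conj1g conjgE invgK.
by rewrite !mulgA mulgV mul1g mulgK => ->.
Qed.

(** Finite quotients separate the elements of the base group, which gives the
    embedding without Britton's lemma. *)
Lemma hnn_base_rho_inj : injective (hnn_base (rho m n)).
Proof.
move=> a b eab; apply/eqP; rewrite -divg_eq1; apply/negPn/negP.
move=> /hnn_rho_base_separated[H [f]].
by rewrite hnn_base_multiplicative group_morphV eab mulgV group_morph1 eqxx.
Qed.

End RhoHNN.

(** * Shears, dilations and scalar matrices *)

Section Shear.
Variables (R : comUnitRingType) (m : nat) (i : 'I_m).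

(** The identity plus the row u placed in row i.  The entry of u in column i is
    ignored, which makes u |-> shear_mx u additive on all row vectors. *)
Definition shear_mx (u : 'rV[R]_m) : 'M[R]_m :=
  \matrix_(a, b) ((a == b)%:R + (if (a == i) && (b != i) then u 0 b else 0)).

Lemma shear_mxE (u : 'rV[R]_m) n (P : 'M[R]_(m, n)) a b :
  (shear_mx u *m P) a b = P a b + (if a == i then \sum_(j | j != i) u 0 j * P j b else 0).
Proof.
rewrite mxE; under eq_bigr do rewrite mxE mulrDl.
rewrite big_split /=; congr (_ + _).
  rewrite (bigD1 a) //= eqxx mul1r big1 ?addr0 // => j /negbTE ja.
  by rewrite eq_sym ja mul0r.
case: (a == i) => /=; last by rewrite big1 // => j _; rewrite mul0r.
rewrite [RHS]big_mkcond; apply: eq_bigr => j _.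
by case: (j != i); rewrite ?mul0r.
Qed.

Lemma shear_mxD (u v : 'rV[R]_m) : shear_mx (u + v) = shear_mx u *m shear_mx v.
Proof.
apply/matrixP => a b; rewrite shear_mxE !mxE -addrA; congr (_ + _).
case: (a == i) => /=; last by rewrite addr0.
under eq_bigr => j ji do rewrite !mxE (negbTE ji) /= addr0.
case: (eqVneq b i) => [->|bi] /=.
  by rewrite add0r big1 // => j /negbTE ->; rewrite mulr0.
rewrite (bigD1 b) //= eqxx mulr1 big1 ?addr0 1?addrC // => j /andP[_ /negbTE ->].
by rewrite mulr0.
Qed.

Lemma shear_mx0 : shear_mx 0 = 1%:M.
Proof. by apply/matrixP => a b; rewrite !mxE; case: ifP; rewrite addr0. Qed.

Fact shear_unitmx u : shear_mx u \in unitmx.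
Proof.
have /mulmx1_unit[] // : shear_mx u *m shear_mx (- u) = 1%:M.
by rewrite -shear_mxD subrr shear_mx0.
Qed.

Definition shear (u : 'rV[R]_m) : GL m R := GLmx (shear_unitmx u).

Lemma shearD u v : shear (u + v) = (shear u * shear v)%g.
Proof. by apply: val_inj; apply: shear_mxD. Qed.

Lemma shear0 : shear 0 = 1%g.
Proof. by apply: val_inj; apply: shear_mx0. Qed.

End Shear.

Lemma GL_map_shear (R S : comUnitRingType) (f : {rmorphism R -> S}) m (i : 'I_m) u :
  GL_map f (shear i u) = shear i (map_mx f u).
Proof.
apply/val_inj/matrixP => a b; rewrite !mxE rmorphD rmorph_nat; congr (_ + _).
by case: ifP; rewrite ?mxE ?rmorph0.
Qed.

Section Scalar.
Variables (R : comUnitRingType) (m : nat).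

Fact GL_scalar_unitmx (z : R) : z \is a GRing.unit -> z%:M \in @unitmx R m.
Proof. by move=> uz; rewrite unitmxE det_scalar unitrX. Qed.

Definition GL_scalar (z : R) (uz : z \is a GRing.unit) : GL m R :=
  GLmx (GL_scalar_unitmx uz).

Lemma GL_scalarX (z : R) (uz : z \is a GRing.unit) k :
  val (GL_scalar uz ^+ k)%g = (z ^+ k)%:M.
Proof.
elim: k => [|k IH] //=; rewrite expgS exprS scalar_mxM -IH; exact: erefl.
Qed.

End Scalar.

Section Dilation.
Variables (R : comUnitRingType) (m : nat) (i : 'I_m).

Definition dilation_mx (z : R) : 'M[R]_m := diag_mx (\row_j (if j == i then z else 1)).

Lemma dilation_mxE z n (P : 'M[R]_(m, n)) a b :
  (dilation_mx z *m P) a b = if a == i then z * P a b else P a b.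
Proof. by rewrite mul_diag_mx !mxE; case: (a == i); rewrite ?mul1r. Qed.

Lemma det_dilation_mx z : \det (dilation_mx z) = z.
Proof.
rewrite det_diag (bigD1 i) //= mxE eqxx big1 ?mulr1 // => j /negbTE ji.
by rewrite mxE ji.
Qed.

Fact dilation_unitmx z : z \is a GRing.unit -> dilation_mx z \in unitmx.
Proof. by rewrite unitmxE det_dilation_mx. Qed.

Definition dilation z (uz : z \is a GRing.unit) : GL m R := GLmx (dilation_unitmx uz).

Lemma shear_dilation z (uz : z \is a GRing.unit) (u : 'rV[R]_m) :
  shear i (z *: u) = (dilation uz * shear i u * (dilation uz)^-1)%g.
Proof.
apply: (canRL (mulgK _)); apply/val_inj/matrixP => a b.
rewrite [LHS]shear_mxE [RHS]dilation_mxE !mxE.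
have [->|ai] /= := eqVneq a i; last first.
  by rewrite !addr0.
rewrite mulrDr; congr (_ + _); first by rewrite mulr_natr.
case: (eqVneq b i) => [->|bi] /=.
  by rewrite mulr0 big1 // => j ji; rewrite !mxE (negbTE ji) mulr0n mulr0.
rewrite (bigD1 b) //= !mxE eqxx (negbTE bi) mulr1 big1 ?addr0 // => j /andP[_ /negbTE jb].
by rewrite !mxE jb mulr0.
Qed.

End Dilation.

(** * Non-linearity *)

Section Involutions.
Variable F : fieldType.
Hypothesis two_neq0 : 2 != 0 :> F.

(** The minimal polynomial divides (X - 1)(X + 1), which has distinct roots. *)
Lemma involution_diagonalizable k (A : 'M[F]_k) : A *m A = 1%:M -> diagonalizable A.
Proof.
case: k A => [|k] A AA.
  by exists 1%:M; [rewrite unitmx1|apply/is_diag_mxP => -[]].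
apply/diagonalizableP; exists [:: 1; -1].
  rewrite /= andbT inE; apply: contra two_neq0 => /eqP e.
  by rewrite -[2]/(1 + 1) {2}e subrr.
apply/mxminpoly_minP; rewrite big_cons big_seq1 rmorphN opprK.
rewrite rmorphM rmorphB rmorphD /= horner_mx_X horner_mx_C.
by rewrite mulrDr mulr1 mulrBl mul1r -!mulmxE AA addrC subrKA subrr.
Qed.

(** In a common eigenbasis such a matrix is determined by its signs. *)
Lemma commuting_involutions_bound k (s : seq 'M[F]_k) : uniq s ->
  {in s &, forall A B, comm_mx A B} -> {in s, forall A, A *m A = 1%:M} ->
  (size s <= 2 ^ k)%N.
Proof.
move=> us cs is1.
have /codiagonalizableP[P uP /allP sP] :
    {in s &, forall A B, comm_mx A B} /\ (forall A, A \in s -> diagonalizable A).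
  by split=> // A /is1/involution_diagonalizable.
pose sgn A : {ffun 'I_k -> bool} := [ffun i => (P *m A *m invmx P) i i == 1].
have dA A : A \in s -> exists2 d : 'rV[F]_k, P *m A *m invmx P = diag_mx d &
    forall i, d 0 i = if sgn A i then 1 else -1.
  move=> sA; have /similar_diagPex[d] := sP A sA => /(similarP uP) e.
  have eA : P *m A *m invmx P = diag_mx d by rewrite e mulmxK.
  exists d => // i; rewrite ffunE eA mxE eqxx mulr1n.
  have : diag_mx d *m diag_mx d = 1%:M.
    by rewrite -eA -!mulmxA (mulmxA (invmx P)) mulVmx // mul1mx (mulmxA A) is1 // mul1mx mulmxV.
  move/matrixP/(_ i i); rewrite mulmx_diag !mxE eqxx !mulr1n => /eqP.
  by rewrite -expr2 sqrf_eq1; case: eqP => [//|_ /eqP].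
have inj : {in s &, injective sgn}.
  move=> A B sA sB e; have [d eA dE] := dA A sA; have [d' eB dE'] := dA B sB.
  have edd : d = d' by apply/rowP => i; rewrite dE dE' e.
  have -> : A = invmx P *m (P *m A *m invmx P) *m P.
    by rewrite !mulmxA mulVmx // mul1mx mulmxKV.
  by rewrite eA edd -eB !mulmxA mulVmx // mul1mx mulmxKV.
rewrite -(size_map sgn) -[X in (_ <= X ^ _)%N]card_bool -[X in (_ <= _ ^ X)%N]card_ord.
rewrite -card_ffun -(card_uniqP _) ?map_inj_in_uniq //; exact: max_card.
Qed.

End Involutions.

Section VandermondeTrick.
Variable F : fieldType.

(** The vector of coefficients of chi times the Vandermonde matrix of the x_j is
    the vector of the chi(x_j).  Multiplying by the adjugate and reading the
    column of the leading coefficient, which is 1, gives the determinant. *)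
Lemma vandermonde_root_comb (chi : {poly F}) (d : nat) (x : 'I_d.+1 -> {poly F}) :
  chi \is monic -> size chi = d.+1 ->
  exists c : 'I_d.+1 -> {poly F},
    \prod_(i < d.+1) \prod_(j < d.+1 | (i < j)%N) (x j - x i) =
    \sum_j (chi \Po x j) * c j.
Proof.
move=> /monicP chi1 size_chi; pose V := Vandermonde d.+1 (\row_j x j).
pose r : 'rV[{poly F}]_d.+1 := \row_i (chi`_i)%:P.
exists (fun j => (\adj V) j ord_max).
transitivity (\det V).
  by rewrite det_Vandermonde; apply: eq_bigr => i _; apply: eq_bigr => j _; rewrite !mxE.
have : (r *m V *m \adj V) 0 ord_max = \det V.
  rewrite -mulmxA mul_mx_adj mul_mx_scalar !mxE /=.
  by move: chi1; rewrite lead_coefE size_chi /= => ->; rewrite mulr1.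
move=> <-; rewrite mxE; apply: eq_bigr => j _; congr (_ * _).
rewrite mxE comp_polyE size_chi; apply: eq_bigr => i _.
by rewrite !mxE mul_polyC.
Qed.

Lemma horner_mx_comp_Xn k (M : 'M[F]_k.+1) (p : {poly F}) e :
  horner_mx M (p \Po 'X^e) = horner_mx (M ^+ e) p.
Proof.
elim/poly_ind: p => [|p c IH]; first by rewrite comp_poly0 !rmorph0.
rewrite comp_polyD comp_polyM comp_polyX comp_polyC !rmorphD !rmorphM /= IH.
by rewrite !horner_mx_C horner_mx_X rmorphXn /= horner_mx_X.
Qed.

Lemma dvdp_subXn1 (a N : nat) : (a %| N)%N -> ('X^a - 1 : {poly F}) %| 'X^N - 1.
Proof. by move=> /dvdnP[b ->]; rewrite mulnC exprM (subrX1 'X^a) dvdp_mulr. Qed.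

Lemma prod_dvdp_exp (I : Type) (r : seq I) (P : pred I) (E : I -> {poly F}) G :
  (forall i, P i -> exists C, E i %| G ^+ C) ->
  exists C, \prod_(i <- r | P i) E i %| G ^+ C.
Proof.
move=> EG; elim/big_ind: _ => [|u v [C uC] [D vD]|//]; first by exists 0%N.
by exists (C + D)%N; rewrite exprD dvdp_mul.
Qed.

(** The matrices M^(q^j) are conjugate to M, so they are all annihilated by the
    characteristic polynomial chi of M.  Taking one more of them than the degree
    of chi, the Vandermonde determinant forces the product of the differences
    M^(q^j) - M^(q^i) over i < j to vanish: this replaces the remark that each
    eigenvalue is a root of unity and avoids any extension of F.  For a common
    multiple N of the q^j - q^i with i < j, the invertible M thus satisfies
    (M^N - 1)^C = 0, and raising to a power of p gives M^(N p^C) = 1. *)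
Lemma conj_pow_finite_order p k q (M T : 'M[F]_k) : p \in [pchar F] -> (1 < q)%N ->
  M \in unitmx -> T \in unitmx -> T *m M *m invmx T = M ^+ q ->
  exists2 N, (0 < N)%N & M ^+ N = 1%:M.
Proof.
case: k M T => [|k] M T pcharF q1 uM uT TM.
  by exists 1%N => //; apply/matrixP => -[].
pose chi := char_poly M.
have chi0 j : horner_mx (M ^+ (q ^ j)) chi = 0.
  elim: j => [|j IH]; first by rewrite expr1 Cayley_Hamilton.
  rewrite expnS exprM -TM.
  have -> : (T *m M *m invmx T) ^+ (q ^ j) = T *m (M ^+ (q ^ j)) *m invmx T.
    have eX (A : 'M[F]_k.+1) : A ^+ (q ^ j) = horner_mx A 'X^(q ^ j).
      by rewrite rmorphXn /= horner_mx_X.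
    by rewrite !eX horner_mx_uconj.
  by rewrite horner_mx_uconj // IH mulmx0 mul0mx.
have [c ec] := vandermonde_root_comb (fun j : 'I_k.+2 => 'X^(q ^ j))
  (char_poly_monic M) (size_char_poly M).
pose N := (\prod_(i < k.+2) \prod_(j < k.+2 | i < j) (q ^ j - q ^ i))%N.
have ltq (i j : 'I_k.+2) : (i < j)%N -> (q ^ i < q ^ j)%N by rewrite ltn_exp2l.
have N0 : (0 < N)%N.
  by apply: prodn_gt0 => i; apply: prodn_cond_gt0 => j /ltq; rewrite subn_gt0.
pose G : {poly F} := 'X^(q ^ k.+1) * ('X^N - 1).
have [C dvdC] : exists C, \sum_(j < k.+2) (chi \Po 'X^(q ^ j)) * c j %| G ^+ C.
  rewrite -ec; apply: prod_dvdp_exp => i _; apply: prod_dvdp_exp => j ij.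
  exists 1%N; rewrite expr1.
  have -> : 'X^(q ^ j) - 'X^(q ^ i) = 'X^(q ^ i) * ('X^(q ^ j - q ^ i) - 1) :> {poly F}.
    by rewrite mulrBr mulr1 -exprD subnKC // ltnW // ltq.
  rewrite dvdp_mul //; first by rewrite dvdp_exp2l // leq_exp2l // -ltnS.
  by rewrite dvdp_subXn1 // /N (bigD1 i) //= (bigD1 j) //= -!mulnA dvdn_mulr.
have HG : horner_mx M (G ^+ C) = 0.
  have /dvdpP[s ->] := dvdC; rewrite rmorphM rmorph_sum /= big1 ?mulr0 // => j _.
  by rewrite rmorphM /= horner_mx_comp_Xn chi0 mul0r.
have {HG} HG : horner_mx M (('X^N - 1) ^+ C) = 0.
  move: HG; rewrite exprMn -exprM rmorphM rmorphXn /= horner_mx_X.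
  by move/(canRL (mulKr (unitrX _ uM))); rewrite mulr0.
exists (N * p ^ C)%N; first by rewrite muln_gt0 N0 expn_gt0 prime_gt0 // (pcharf_prime pcharF).
have eX : 'X^(N * p ^ C) = ('X^N - 1) ^+ (p ^ C) + 1 :> {poly F}.
  rewrite -[1 in X in _ + X](expr1n _ (p ^ C)) -exprDn_pchar ?subrK ?exprM //.
  by rewrite pnatX (eq_pnat _ (pchar_poly F)) pnatE ?(pcharf_prime pcharF) // pcharF.
rewrite -(horner_mx_X M) -rmorphXn /= eX rmorphD rmorph1 /=.
have leC : (C <= p ^ C)%N by rewrite ltnW // ltn_expl // prime_gt1 // (pcharf_prime pcharF).
by rewrite -(subnKC leC) exprD rmorphM /= HG mul0r add0r.
Qed.

End VandermondeTrick.

Lemma laurent_tX_inj (F : fieldType) : injective (fun e : nat => laurent_t F ^+ e).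
Proof.
move=> e e'; rewrite -!rmorphXn => /laurent_poly_inj /(congr1 (fun p : {poly F} => size p)).
by rewrite !size_polyXn => -[].
Qed.

Section Nonlinear.
Variables (k m : nat) (F : fieldType).
Local Notation R := (laurent 'F_2).

(** The group GL(m,R) contains an infinite elementary abelian 2-group, namely
    the elementary matrices 1 + t^e E_12 and their products, which has no faithful
    linear representation outside characteristic 2. *)
Lemma GL_laurent_linear_char2 (h : {multiplicative GL m.+2 R -> GL k F}) :
  injective h -> (2 : F) = 0.
Proof.
move=> h_inj; apply/eqP/negPn/negP => two_neq0.
pose u e : 'rV[R]_m.+2 := laurent_t 'F_2 ^+ e *: delta_mx 0 (lift ord0 ord0).
pose s e := shear ord0 (u e).
have two0 : (2 : R) = 0.
  rewrite -(rmorph_nat (laurent_const 'F_2)) -(rmorph0 (laurent_const 'F_2)).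
  by congr (laurent_const _ _); apply: val_inj.
have ss e : (s e * s e)%g = 1%g.
  by rewrite -shearD -[u e + _]mulr2n -scaler_nat two0 scale0r shear0.
have sC e e' : (s e * s e' = s e' * s e)%g by rewrite -!shearD addrC.
have s_inj : injective s.
  move=> e e' /(congr1 val) /matrixP /(_ ord0 (lift ord0 ord0)).
  by rewrite !mxE !eqxx /= !mulr1 => /addrI /laurent_tX_inj.
have hM x y : val (h (x * y)%g) = val (h x) *m val (h y) by rewrite gmulfM.
pose l := [seq val (h (s e)) | e <- iota 0 (2 ^ k).+1].
have : (size l <= 2 ^ k)%N.
  apply: commuting_involutions_bound => //.
  - rewrite map_inj_uniq ?iota_uniq // => e e' /val_inj /h_inj; exact: s_inj.
  - move=> _ _ /mapP[e _ ->] /mapP[e' _ ->].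
    by rewrite /comm_mx -!hM sC.
  - move=> _ /mapP[e _ ->].
    by rewrite -hM ss group_morph1.
by rewrite size_map size_iota ltnn.
Qed.

End Nonlinear.

Section ScalarT.
Variables (m : nat) (F : fieldType).

Definition GL_t (z : int) : GL m (laurent F) := GL_scalar m (laurent_tX_unit F z).

Lemma GL_t_subst n z : GL_map (laurent_subst n) (GL_t z) = GL_t (n * z).
Proof.
apply: val_inj; rewrite /= map_scalar_mx /=.
by rewrite rmorphXz ?laurent_t_unit //= laurent_subst_t exprz_exp.
Qed.

Lemma GL_tX z e : (GL_t z ^+ e)%g = GL_t (z * e).
Proof. by apply: val_inj; rewrite GL_scalarX /= -exprz_exp. Qed.

End ScalarT.

Lemma hnn_rho_nonlinear (m : nat) (n : int) :
  (2 <= m)%N -> 1 < `|n| -> ~ linear_group (hnn (rho m n)).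
Proof.
case: m => [//|[//|m]] _ n1 [F [k [f f_inj]]].
have n0 : n != 0 by rewrite -normr_gt0 (lt_trans ltr01).
have char2 : 2%N \in [pchar F].
  apply/andP; split => //; apply/eqP.
  apply: (@GL_laurent_linear_char2 k m F (f \o hnn_base _)).
  exact: inj_comp f_inj (hnn_base_rho_inj n0).
pose x := hnn_base (rho m.+2 n) (GL_t m.+2 'F_2 1); pose T := hnn_tau (rho m.+2 n).
(* Conjugating twice makes the exponent n^2 positive whatever the sign of n. *)
have conjx : (T ^+ 2 * x * T ^- 2 = x ^+ (`|n| ^ 2))%g.
  rewrite hnn_tauX_base mulgK /= !GL_t_subst mulr1.
  rewrite -group_morphX GL_tX mul1r -mulnn PoszM !abszE -normrM -!expr2.
  by rewrite ger0_norm ?sqr_ge0.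
have fM y z : val (f (y * z)%g) = val (f y) *m val (f z) by rewrite gmulfM.
have fX y e : val (f (y ^+ e)%g) = val (f y) ^+ e.
  by elim: e => [|e IH]; rewrite ?expg0 ?group_morph1 // expgS exprS fM IH.
have [||||N N0 fN] := @conj_pow_finite_order F 2 k (`|n| ^ 2)
  (val (f x)) (val (f (T ^+ 2)%g)) char2.
- by rewrite -(exp1n 2) ltn_exp2r // -ltz_nat abszE.
- exact: valP.
- exact: valP.
- by rewrite -fX -conjx (fM (T ^+ 2 * x)%g) (fM (T ^+ 2)%g) group_morphV.
have xN : (x ^+ N)%g = 1%g.
  by apply: f_inj; apply: val_inj; rewrite fX fN group_morph1.
have : GL_t m.+2 'F_2 N = 1%g.
  apply: (hnn_base_rho_inj n0).
  by rewrite -[N%:Z]mul1r -GL_tX group_morphX xN group_morph1.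
move=> /(congr1 val) /matrixP /(_ 0 0); rewrite !mxE eqxx !mulr1n => tN.
by have /laurent_tX_inj eN : laurent_t 'F_2 ^+ N = laurent_t 'F_2 ^+ 0; [|rewrite eN in N0].
Qed.

(** * Finite generation *)

Section Generated.
Variables (G : groupType) (s : seq G).
Local Open Scope group_scope.

Definition generated_by (x : G) : Prop := exists w : seq G,
  all (fun y => (y \in s) || (y^-1 \in s)) w /\ x = \prod_(y <- w) y.

Lemma generated_by1 : generated_by 1.
Proof. by exists [::]; rewrite big_nil. Qed.

Lemma generated_byM x y : generated_by x -> generated_by y -> generated_by (x * y).
Proof. by move=> [u [su ->]] [v [sv ->]]; exists (u ++ v); rewrite all_cat su sv big_cat. Qed.

Lemma generated_byV x : generated_by x -> generated_by x^-1.
Proof.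
move=> [w [+ ->]]; elim: w => [|y w IH] /=.
  by rewrite big_nil invg1 => _; apply: generated_by1.
move=> /andP[sy /IH gw]; rewrite big_cons invgM; apply: generated_byM => //.
by exists [:: y^-1]; rewrite big_seq1 /= invgK orbC sy.
Qed.

Lemma generated_by_mem x : x \in s -> generated_by x.
Proof. by move=> sx; exists [:: x]; rewrite big_seq1 /= sx. Qed.

End Generated.

Section CoefDet.
Variable K : comNzRingType.

Lemma coef_prod_top (I : Type) (r : seq I) (d : I -> nat) (E : I -> {poly K}) :
  (forall i, size (E i) <= (d i).+1)%N ->
  (\prod_(i <- r) E i)`_(\sum_(i <- r) d i)%N = \prod_(i <- r) (E i)`_(d i).
Proof.
move=> sE; suff [] : (size (\prod_(i <- r) E i)%R <= (\sum_(i <- r) d i).+1)%N /\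
  (\prod_(i <- r) E i)`_(\sum_(i <- r) d i)%N = \prod_(i <- r) (E i)`_(d i) by [].
elim/big_rec3: _ => [|i c n p _ [sp <-]]; first by rewrite size_poly1 coef1.
split.
  apply: leq_trans (size_polyMleq _ _) _.
  by rewrite -subn1 leq_subLR add1n -addnS -addSn; apply: leq_add.
have dn : (d i < (d i + n).+1)%N by rewrite ltnS leq_addr.
rewrite coefM (bigD1 (Ordinal dn)) //= addKn big1 ?addr0 // => j.
rewrite -val_eqE /= neq_ltn => /orP[lt_j|gt_j].
  rewrite [p`__]nth_default ?mulr0 //; apply: leq_trans sp _.
  by rewrite ltn_subRL ltn_add2r.
by rewrite nth_default ?mul0r //; apply: leq_trans (sE i) _.
Qed.

(** With d bounding the row degrees, the coefficient of the determinant in degree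
    the sum of the d i only involves the top coefficient of each entry. *)
Lemma coef_det_top m (P : 'M[{poly K}]_m) (d : 'I_m -> nat) :
  (forall i j, size (P i j) <= (d i).+1)%N ->
  (\det P)`_(\sum_i d i)%N = \det (\matrix_(i, j) (P i j)`_(d i)).
Proof.
move=> sP; rewrite /determinant coef_sum; apply: eq_bigr => s _.
rewrite !mulr_sign; under [in RHS]eq_bigr do rewrite mxE.
rewrite -(@coef_prod_top _ _ d (fun i => P i (s i))) //.
by case: ifP; rewrite ?coefN.
Qed.

End CoefDet.

Section PolynomialMatrices.
Variables (K : fieldType) (m : nat).
Local Notation R := (laurent K).

Definition dilation_t (i : 'I_m) : GL m R := dilation i (laurent_t_unit K).

Definition row_size (P : 'M[{poly K}]_m) (i : 'I_m) : nat := \max_j size (P i j).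

Lemma size_entry_le (P : 'M[{poly K}]_m) i j : (size (P i j) <= row_size P i)%N.
Proof. exact: leq_bigmax. Qed.

(** This prepares a row operation that replaces row i by the combination of the
    rows with coefficients w.  Taking i with d i maximal on the support of w
    leaves room to multiply each row j that occurs by X^(d i - d j). *)
Lemma singular_relation (A : 'M[K]_m) (d : 'I_m -> nat) : \det A = 0 ->
  exists (i : 'I_m) (w : 'rV[K]_m),
    [/\ w 0 i = 1, w *m A = 0 & forall j, w 0 j != 0 -> (d j <= d i)%N].
Proof.
move=> /eqP/det0P[v /rV0Pn[i0 vi0] vA].
case: (@arg_maxnP _ i0 (fun j => v 0 j != 0) d vi0) => i vi imax.
exists i, ((v 0 i)^-1 *: v); split; first by rewrite !mxE mulVf.
- by rewrite -scalemxAl vA scaler0.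
- by move=> j; rewrite !mxE mulf_eq0 negb_or => /andP[_ /imax].
Qed.

Lemma shear_row (S : comUnitRingType) (i : 'I_m) (w : 'rV[S]_m) (P : 'M[S]_m) b :
  w 0 i = 1 -> (shear_mx i w *m P) i b = \sum_j w 0 j * P j b.
Proof. by move=> wi; rewrite shear_mxE eqxx [RHS](bigD1 i) //= wi mul1r. Qed.

Lemma shear_row_neq (S : comUnitRingType) (i : 'I_m) (w : 'rV[S]_m) (P : 'M[S]_m) a b :
  a != i -> (shear_mx i w *m P) a b = P a b.
Proof. by move=> /negbTE ai; rewrite shear_mxE ai addr0. Qed.

(** Being invertible as a Laurent polynomial, p divides a power of X; being
    nonzero at 0, it is prime to X. *)
Lemma laurent_poly_unit (p : {poly K}) :
  laurent_poly p \is a GRing.unit -> p.[0] != 0 -> p \is a GRing.unit.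
Proof.
move=> up p0; have [q [k eq]] := laurentP (laurent_poly p)^-1.
have pq : p * q = 'X^k.
  apply: laurent_poly_inj; rewrite rmorphM rmorphXn /= -/(laurent_t K).
  have tk := unitrX k (laurent_t_unit K).
  have -> : laurent_poly q = (laurent_poly p)^-1 * laurent_t K ^+ k.
    by rewrite eq (mulrVK tk).
  exact: (mulVKr up).
have cop : coprimep p 'X^k by rewrite coprimep_expr // coprimepX.
have := coprimep_dvdl (dvdp_mulr q (dvdpp p)); rewrite pq => /(_ _ cop).
rewrite coprimepp => /eqP size_p; rewrite poly_unitE size_p eqxx /=.
by rewrite unitfE -horner_coef0.
Qed.

Lemma laurent_mx_denominator (A : 'M[R]_m) :
  exists (N : nat) (P : 'M[{poly K}]_m), laurent_t K ^+ N *: A = map_mx (@laurent_poly K) P.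
Proof.
have /fin_all_exists[f fP] (ij : 'I_m * 'I_m) : exists pk : {poly K} * nat,
    A ij.1 ij.2 = laurent_poly pk.1 / laurent_t K ^+ pk.2.
  by have [p [k e]] := laurentP (A ij.1 ij.2); exists (p, k).
pose N := \max_ij (f ij).2.
exists N, (\matrix_(i, j) ((f (i, j)).1 * 'X^(N - (f (i, j)).2))).
apply/matrixP => i j; rewrite !mxE (fP (i, j)) rmorphM rmorphXn /= -/(laurent_t K).
have leN : ((f (i, j)).2 <= N)%N by apply: (leq_bigmax (i, j)).
rewrite mulrC -{1}(subnK leN) exprD [_ * laurent_t K ^+ (f (i, j)).2]mulrC mulrA.
by rewrite divrK // unitrX // laurent_t_unit.
Qed.

End PolynomialMatrices.

(** From here on, H is a subgroup of GL(m,K[t,t^-1]) containing the constant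
    matrices, the dilations by t and the scalar t. *)

Section Generation.
Variables (K : fieldType) (m : nat).
Local Notation R := (laurent K).

Variable H : GL m R -> Prop.
Hypotheses (H1 : H 1%g) (HM : forall g h, H g -> H h -> H (g * h)%g)
  (HV : forall g, H g -> H g^-1%g).
Hypothesis H_const : forall c : GL m K, H (GL_map (laurent_const K) c).
Hypothesis H_dilation : forall i, H (dilation_t K i).
Hypothesis H_scalar : H (GL_scalar m (laurent_t_unit K)).

Lemma subgroup_cancel g h : H g -> H (g * h)%g -> H h.
Proof. by move=> Hg Hgh; rewrite -(mulKg g h); apply/HM/Hgh/HV. Qed.

(** The shears along row i are additive in u, constant ones lie in H, and
    conjugation by the dilation multiplies u by t: Horner's scheme does the
    rest. *)
Lemma subgroup_shear i (u : 'rV[{poly K}]_m) : H (GL_map (@laurent_poly K) (shear i u)).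
Proof.
rewrite (row_sum_delta u).
elim/big_ind: _ => [|v w Hv Hw|j _].
- by rewrite shear0 group_morph1.
- by rewrite shearD gmulfM; apply: HM.
elim/poly_ind: (u 0 j) => [|p c IH].
  by rewrite scale0r shear0 group_morph1.
rewrite scalerDl shearD gmulfM /=; apply: HM.
  rewrite GL_map_shear in IH.
  rewrite mulrC -scalerA GL_map_shear map_mxZ (shear_dilation _ (laurent_t_unit K)).
  by apply: HM; [apply: HM |apply: HV] => //; apply: H_dilation.
have -> : c%:P *: delta_mx 0 j = map_mx polyC (c *: delta_mx 0 j) :> 'rV[{poly K}]_m.
  by rewrite map_mxZ map_delta_mx.
rewrite -GL_map_shear; have := H_const (shear i (c *: delta_mx 0 j)).
by congr H; apply/val_inj/matrixP => a b; rewrite !mxE.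
Qed.

(** Induction on the sum of the row sizes.  A relation between the leading row
    coefficients lifts to a row operation that lowers one row size, and without
    such a relation all row degrees are 0, as their sum is the degree of the
    determinant. *)
Lemma subgroup_GL_poly (P : GL m {poly K}) : H (GL_map (@laurent_poly K) P).
Proof.
have [n] := ubnP (\sum_i row_size (val P) i)%N; elim: n P => // n IH P ltn.
pose d i := (row_size (val P) i).-1.
have size_d i j : (size (val P i j) <= (d i).+1)%N.
  exact: leq_trans (size_entry_le _ i j) (leqSpred _).
pose L : 'M[K]_m := \matrix_(i, j) (val P i j)`_(d i).
have [detL|detL] := eqVneq (\det L) 0; last first.
  have : size (\det (val P)) = 1%N.
    by have := valP P; rewrite unitmxE poly_unitE => /andP[/eqP].
  (* Here the sum of the row degrees is the degree of det P, that is 0. *)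
  rewrite /L -coef_det_top // in detL => size1.
  have /eqP : (\sum_i d i)%N = 0%N.
    apply/eqP; rewrite -leqn0 -ltnS -size1 ltnNge.
    by apply: contraNN detL => /leq_sizeP ->.
  rewrite sum_nat_eq0 => /forallP d0.
  have eP : val P = map_mx polyC (\matrix_(i, j) (val P i j)`_0).
    apply/matrixP => i j; rewrite !mxE -size1_polyC //.
    by have := size_d i j; rewrite (eqP (d0 i)).
  have uP : \matrix_(i, j) (val P i j)`_0 \in unitmx.
    have := valP P; rewrite {1}eP !unitmxE det_map_mx poly_unitE => /andP[_].
    by rewrite coefC.
  have := H_const (GLmx uP); congr H; apply/val_inj.
  by rewrite /= [in RHS]eP; apply/matrixP => i j; rewrite !mxE.
have [i [w [wi wL wmax]]] := singular_relation (row_size (val P)) detL.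
pose rs := row_size (val P).
(* Shifting each row j to the degree of row i aligns the leading terms, which
   then cancel by the relation w. *)
pose W : 'rV[{poly K}]_m := \row_j (w 0 j *: 'X^(rs i - rs j)).
have Wi : W 0 i = 1 by rewrite mxE wi subnn scale1r.
pose P' := (shear i W * P)%g.
have rs_neq a : a != i -> row_size (val P') a = rs a.
  by move=> ai; apply: eq_bigr => b _; rewrite /= shear_row_neq.
have rs_i_gt0 : (0 < rs i)%N.
  rewrite lt0n; apply/eqP => rs0.
  have P0 j : val P i j = 0.
    by apply/eqP; rewrite -size_poly_eq0 -leqn0 -rs0 size_entry_le.
  have /matrixP/(_ i i) := mulmxV (valP P); rewrite !mxE eqxx big1 => [/eqP|j _].
    by rewrite eq_sym oner_eq0.
  by rewrite P0 mul0r.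
have rs_lt : (row_size (val P') i < rs i)%N.
  rewrite -(prednK rs_i_gt0) ltnS; apply/bigmax_leqP => b _.
  rewrite /= shear_row //; apply/leq_sizeP => e; rewrite leq_eqVlt coef_sum.
  case/orP => [/eqP <-|lte]; last first.
    apply: big1 => j _; rewrite mxE -scalerAl coefZ.
    have [->|/wmax le_ji] := eqVneq (w 0 j) 0; first by rewrite mul0r.
    rewrite coefXnM nth_default ?if_same ?mulr0 //.
    apply: leq_trans (size_entry_le _ _ _) _; rewrite leq_subRL.
      by rewrite subnK // -ltnS -(prednK rs_i_gt0) ltnS.
    by rewrite (leq_trans (leq_subr _ _)) // -(prednK rs_i_gt0).
  transitivity (\sum_j w 0 j * L j b); last by have /rowP/(_ b) := wL; rewrite !mxE.
  apply: eq_bigr => j _; rewrite !mxE -scalerAl coefZ.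
  have [->|/wmax le_ji] := eqVneq (w 0 j) 0; first by rewrite !mul0r.
  congr (_ * _); rewrite coefXnM.
  have [rsj0|rsj] := posnP (rs j).
    have /eqP -> : val P j b == 0.
      by rewrite -size_poly_eq0 -leqn0 -rsj0 size_entry_le.
    by rewrite !coef0 if_same.
  have e1 : ((rs i).-1 - (rs i - rs j))%N = (rs j).-1.
    by rewrite -!subn1 -subnDA addnC subnDA subKn.
  have -> : ((rs i).-1 < rs i - rs j)%N = false.
    by rewrite ltnNge -ltnS prednK // ltn_subrL rsj rs_i_gt0.
  by rewrite e1.
apply: (subgroup_cancel (subgroup_shear i W)); rewrite -gmulfM; apply: IH.
rewrite -ltnS; apply: leq_trans ltn; rewrite ltnS (bigD1 i) //= [ltnRHS](bigD1 i) //=.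
rewrite -addSn leq_add //; apply: leq_sum => a ai.
by rewrite [X in (X <= _)%N]rs_neq.
Qed.

(** Induction on the degree of the determinant, which loses a factor X each time
    a relation between the rows at t = 0 is used. *)
Lemma subgroup_poly_mx (P : 'M[{poly K}]_m) (g : GL m R) :
  val g = map_mx (@laurent_poly K) P -> H g.
Proof.
have [n] := ubnP (size (\det P)); elim: n P g => // n IH P g ltn eg.
have udet : laurent_poly (\det P) \is a GRing.unit.
  by have := valP g; rewrite eg unitmxE det_map_mx.
have [det0|det0] := eqVneq (\det P).[0] 0; last first.
  have uP : P \in unitmx by rewrite unitmxE laurent_poly_unit.
  have -> : g = GL_map (@laurent_poly K) (GLmx uP) by apply: val_inj.
  exact: subgroup_GL_poly.
have detP : \det P != 0.
  by apply: contraTneq udet => ->; rewrite rmorph0 unitr0.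
have detP0 : \det (map_mx (horner_eval 0) P) = 0 by rewrite det_map_mx.
have [i [w [wi wP _]]] := singular_relation (fun=> 0%N) detP0.
pose W : 'rV[{poly K}]_m := map_mx polyC w.
have Wi : W 0 i = 1 by rewrite mxE wi.
(* The rows of P satisfy the relation w at t = 0, so that row i of P1 vanishes
   there. *)
pose P1 := shear_mx i W *m P.
pose P2 : 'M[{poly K}]_m := \matrix_(a, b) (if a == i then P1 a b %/ 'X else P1 a b).
have eP1 : P1 = dilation_mx i 'X *m P2.
  apply/matrixP => a b; rewrite dilation_mxE [in RHS]mxE.
  case: eqP => // ->; rewrite mulrC divpK //.
  rewrite -['X]subr0 -polyC0 dvdp_XsubCl /root /P1 shear_row // horner_sum.
  have /rowP/(_ b) := wP; rewrite !mxE => wb; rewrite -[X in _ == X]wb.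
  by apply/eqP; apply: eq_bigr => j _; rewrite !mxE hornerM hornerC.
have size2 : (size (\det P2) < size (\det P))%N.
  have := congr1 determinant eP1; rewrite !det_mulmx det_dilation_mx => e.
  have uS : \det (shear_mx i W) \is a GRing.unit by rewrite -unitmxE shear_unitmx.
  have S0 : \det (shear_mx i W) != 0 by apply: contraTneq uS => ->; rewrite unitr0.
  have D0 : \det P2 != 0.
    by apply: contra_neq (mulf_neq0 S0 detP) => D0; rewrite e D0 mulr0.
  have := congr1 (fun p : {poly K} => size p) e; rewrite !size_mul ?polyX_eq0 //.
  move: uS; rewrite poly_unitE => /andP[/eqP -> _].
  by rewrite size_polyX !addSn !add0n /= => ->.
apply: (subgroup_cancel (subgroup_shear i W)).
set h := (_ * g)%g.
have eh : val h = val (dilation_t K i) *m map_mx (@laurent_poly K) P2.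
  rewrite /h /= eg -map_mxM -/P1 eP1 map_mxM; congr (_ *m _).
  rewrite map_diag_mx; congr diag_mx; apply/rowP => j; rewrite !mxE.
  by case: ifP; rewrite ?rmorph1.
rewrite -(mulVKg (dilation_t K i) h); apply: HM => //.
apply: (IH P2); first exact: leq_trans size2 _.
by apply: etrans (mulKmx (valP (dilation_t K i)) _); rewrite -eh.
Qed.

Lemma subgroup_full (g : GL m R) : H g.
Proof.
have [N [P eP]] := laurent_mx_denominator (val g).
pose z := (GL_scalar m (laurent_t_unit K) ^+ N)%g.
have Hz : H z by rewrite /z; elim: N {z eP} => // N IH; rewrite expgS; apply: HM.
apply: (subgroup_cancel Hz); apply: (subgroup_poly_mx (P := P)).
by rewrite -eP -mul_scalar_mx -(GL_scalarX m (laurent_t_unit K)).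
Qed.

End Generation.

Lemma GL_laurent_finitely_generated (K : finFieldType) (m : nat) :
  finitely_generated (GL m (laurent K)).
Proof.
pose consts : seq (GL m K) := pmap insub (enum {: 'M[K]_m}).
pose s := GL_scalar m (laurent_t_unit K) ::
  map (GL_map (laurent_const K)) consts ++ map (@dilation_t K m) (enum 'I_m).
exists s; apply: (@subgroup_full K m (generated_by s)).
- exact: generated_by1.
- exact: generated_byM.
- exact: generated_byV.
- move=> c; apply: generated_by_mem; rewrite inE mem_cat map_f ?orbT //.
  by rewrite mem_pmap_sub mem_enum.
- move=> i; apply: generated_by_mem; rewrite inE mem_cat.
  by rewrite (map_f (@dilation_t K m)) ?mem_enum ?orbT.
- by apply: generated_by_mem; rewrite mem_head.
Qed.

Lemma hnn_finitely_generated (A : groupType) (phi : {multiplicative A -> A}) :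
  finitely_generated A -> finitely_generated (hnn phi).
Proof.
move=> [s gs]; pose s' := hnn_tau phi :: map (hnn_base phi) s.
exists s'; change (forall x, generated_by s' x).
have gtau : generated_by s' (hnn_tau phi) by apply: generated_by_mem; rewrite mem_head.
elim/hnn_ind => [|a x gx|x gx|x gx].
- exact: generated_by1.
- apply: generated_byM gx; have [w [+ ->]] := gs a.
  elim: w => [_|y w IH /= /andP[sy /IH gw]].
    by rewrite big_nil group_morph1; apply: generated_by1.
  rewrite big_cons gmulfM; apply: generated_byM gw.
  case/orP: sy => sy; last rewrite -[y]invgK group_morphV; last apply: generated_byV.
    by apply: generated_by_mem; rewrite inE map_f ?orbT.
  by apply: generated_by_mem; rewrite inE map_f ?orbT.
- exact: generated_byM gtau gx.
- exact: generated_byM (generated_byV gtau) gx.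
Qed.

(** * The theorem *)

Theorem corollary1p4 (m : nat) (n : int) :
  (3 <= m)%N -> 1 < `|n| ->
  [/\ finitely_generated (hnn (rho m n)),
      ~ linear_group (hnn (rho m n)) &
      residually_finite (hnn (rho m n))].
Proof.
move=> m3 n1; have n0 : n != 0 by rewrite -normr_gt0 (lt_trans ltr01).
split.
- exact/hnn_finitely_generated/GL_laurent_finitely_generated.
- exact: hnn_rho_nonlinear (ltnW m3) n1.
- exact: hnn_rho_residually_finite.
Qed.
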